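(* Let $\Bbbk$ be an algebraically closed field, $G$ an abelian group and $A$ a finite dimensional unital associative $G$-graded $\Bbbk$-algebra. Then, as $G$-graded algebras, $$\mathcal{Z}^G(A)^{\mathrm{op}}\;\cong\;\mathrm{End}(\Pi).$$
   Context: $G$ is written additively. A $G$-graded algebra satisfies $A_gA_h\subset A_{g+h}$; $A\text{-gmod}$ is the category of finite dimensional $G$-graded left $A$-modules with degree-preserving $A$-linear maps. For $g\in G$, $\Pi_g$ is the grading shift functor on $A\text{-gmod}$: $\Pi_gM$ is $M$ as an ungraded module, with $(\Pi_gM)_h=M_{h+g}$; it acts as the identity on underlying linear maps. One has $\Pi_0=\mathrm{Id}$, $\Pi_g\Pi_h=\Pi_{g+h}$. $\mathrm{End}(\Pi):=\bigoplus_{g\in G}\mathrm{Nat}(\mathrm{Id},\Pi_g)$ (functors on $A\text{-gmod}$) is a $G$-graded algebra with $\mathrm{End}(\Pi)_g=\mathrm{Nat}(\mathrm{Id},\Pi_g)$ and product $\alpha\beta:=\Pi_k(\alpha)\circ\beta$ for $\alpha\in\mathrm{Nat}(\mathrm{Id},\Pi_h)$, $\beta\in\mathrm{Nat}(\mathrm{Id},\Pi_k)$. $\Bbbk^G$ is the algebra of all functions $G\to\Bbbk$; $A\otimes\Bbbk^G=\mathrm{Hom}_{\mathbf{Set}}(G,A)$ has pointwise multiplication, elements written $\mathbf{x}:g\mapsto x^{(g)}$, and $G$-grading $(A\otimes\Bbbk^G)_g=A_g\otimes\Bbbk^G$. The $G$-centre is the $G$-graded subalgebra $$\mathcal{Z}^G(A)=\{\mathbf{x}\in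 A\otimes\Bbbk^G\mid x^{(g)}y=yx^{(g+h)}\text{ for all } g,h\in G,\ y\in A_h\}.$$ *)

(* Defs.v *)
From HB Require Import structures.
From mathcomp Require Import all_boot all_order all_algebra.
From mathcomp Require Import finmap all_classical.

Set Implicit Arguments.
Unset Strict Implicit.
Unset Printing Implicit Defensive.

Import GRing.Theory.
Local Open Scope ring_scope.
Local Open Scope classical_set_scope.

(* MathComp's [algType] and [falgType] require 1 != 0.  The structure below   *)
(* does not, so that the zero algebra is allowed.                             *)
HB.mixin Record Vector_isUnitalAlgebra (k : fieldType) A of Vector k A := {
  ua_one : A;
  ua_mul : A -> A -> A;
  ua_mulA : associative ua_mul;
  ua_mul1l : left_id ua_one ua_mul;
  ua_mul1r : right_id ua_one ua_mul;
  ua_mulDl : left_distributive ua_mul +%R;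
  ua_mulDr : right_distributive ua_mul +%R;
  ua_scaleAl : forall (a : k) (x y : A), a *: ua_mul x y = ua_mul (a *: x) y;
  ua_scaleAr : forall (a : k) (x y : A), a *: ua_mul x y = ua_mul x (a *: y)
}.

#[short(type="fdimAlgType")]
HB.structure Definition FdimAlg (k : fieldType) :=
  {A of Vector k A & Vector_isUnitalAlgebra k A}.

HB.instance Definition _ (k : fieldType) (A : fdimAlgType k) :=
  GRing.Zmodule_isPzRing.Build (FdimAlg.sort A)
    (@ua_mulA k A) (@ua_mul1l k A) (@ua_mul1r k A)
    (@ua_mulDl k A) (@ua_mulDr k A).

(* The opposite of an algebra, as a module. *)
HB.instance Definition _ (k : pzRingType) (V : lmodType k) :=
  GRing.Lmodule.on V^c.

(* V is the direct sum of the subspaces gr_deg g, g in G.                     *)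
Record grading (k : fieldType) (G : zmodType) (V : lmodType k) := Grading {
  gr_deg :> G -> set V;
  gr_deg0 : forall g, gr_deg g 0;
  gr_degP : forall g (a : k) (x y : V),
    gr_deg g x -> gr_deg g y -> gr_deg g (a *: x + y);
  gr_span : forall x : V, exists (s : seq G) (y : G -> V),
    [/\ uniq s, forall g, gr_deg g (y g) & x = \sum_(g <- s) y g];
  gr_free : forall (s : seq G) (y : G -> V),
    uniq s -> (forall g, gr_deg g (y g)) -> \sum_(g <- s) y g = 0 ->
    forall g, g \in s -> y g = 0
}.

Record alg_grading (k : fieldType) (G : zmodType) (A : fdimAlgType k) :=
  AlgGrading {
  ag_grading :> grading G A;
  ag_mul : forall g h (x y : A),
    ag_grading g x -> ag_grading h y -> ag_grading (g + h) (x * y)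
}.

Section FiniteSums.
Variables (I : choiceType) (V : nmodType).

Lemma big_support (s t : seq I) (F : I -> V) :
  uniq s -> uniq t ->
  (forall i, i \notin s -> F i = 0) -> (forall i, i \notin t -> F i = 0) ->
  \sum_(i <- s) F i = \sum_(i <- t) F i.
Proof.
move=> us ut s0 t0.
rewrite [LHS](bigID [in t]) [RHS](bigID [in s]) /=.
rewrite [X in _ + X]big1 ?[X in _ = _ + X]big1 ?addr0; last 2 first.
- by move=> i; exact: s0.
- by move=> i; exact: t0.
rewrite -[LHS]big_filter -[RHS]big_filter; apply: perm_big; apply: uniq_perm; rewrite ?filter_uniq //.
by move=> i; rewrite !mem_filter andbC.
Qed.

Lemma fsum_seq (s : seq I) (F : I -> V) :
  uniq s -> (forall i, i \notin s -> F i = 0) ->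
  \sum_(i \in setT) F i = \sum_(i <- s) F i.
Proof.
move=> us s0; rewrite (@fsbigTE _ _ _ _ (seq_fset tt s)); last first.
  by move=> i; rewrite seq_fsetE; exact: s0.
by apply: big_support => // i; rewrite seq_fsetE; exact: s0.
Qed.

End FiniteSums.

Section Components.
Variables (k : fieldType) (G : zmodType) (V : lmodType k) (D : grading G V).

Lemma gr_degD g x y : D g x -> D g y -> D g (x + y).
Proof. by move=> gx gy; rewrite -[x]scale1r; exact: gr_degP. Qed.

Lemma gr_degZ g (a : k) x : D g x -> D g (a *: x).
Proof. by move=> gx; rewrite -[_ *: x]addr0; apply/gr_degP/gr_deg0. Qed.

Lemma gr_degB g x y : D g x -> D g y -> D g (x - y).
Proof. by move=> gx gy; apply: gr_degD => //; rewrite -scaleN1r; exact: gr_degZ. Qed.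

Definition supported (s : seq G) (y : G -> V) :=
  forall g, g \notin s -> y g = 0.

Lemma gr_uniq s t (y z : G -> V) : uniq s -> uniq t ->
  supported s y -> supported t z ->
  (forall g, D g (y g)) -> (forall g, D g (z g)) ->
  \sum_(g <- s) y g = \sum_(g <- t) z g -> y =1 z.
Proof.
move=> us ut sy tz Dy Dz yz g; set u := undup (s ++ t).
have uu : uniq u by exact: undup_uniq.
have su i : i \notin u -> i \notin s /\ i \notin t.
  by rewrite mem_undup mem_cat negb_or => /andP.
have uy : supported u y by move=> i /su[/sy].
have uz : supported u z by move=> i /su[_ /tz].
have [gu|/[dup] /uy -> /uz -> //] := boolP (g \in u).
apply/eqP; rewrite -subr_eq0; apply/eqP.
apply: (@gr_free _ _ _ D u (fun i => y i - z i)) => //.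
  by move=> i; exact: gr_degB.
rewrite big_split /= sumrN (big_support uu us) // (big_support uu ut) //.
by rewrite yz subrr.
Qed.

Lemma gr_comp_subproof : exists p : G -> V -> V,
  (forall g x, D g (p g x)) /\
  forall x, exists s, [/\ uniq s, supported s (p ^~ x) & x = \sum_(g <- s) p g x].
Proof.
have P x : exists y : G -> V, (forall g, D g (y g)) /\
    exists s, [/\ uniq s, supported s y & x = \sum_(g <- s) y g].
  have [s [y [us Dy xE]]] := gr_span D x.
  exists (fun g => if g \in s then y g else 0); split.
    by move=> g; case: ifP => // _; exact: gr_deg0.
  exists s; split=> //; first by move=> g /negbTE ->.
  by rewrite xE; apply: eq_big_seq => g ->.
have [f fP] := choice P; exists (fun g x => f x g); split.
  by move=> g x; have [] := fP x.
by move=> x; have [] := fP x.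
Qed.

Definition gr_comp : G -> V -> V := sval (cid gr_comp_subproof).

Lemma gr_comp_deg g x : D g (gr_comp g x).
Proof. by rewrite /gr_comp; case: cid => p [] /=. Qed.

Lemma gr_comp_sum x : exists s,
  [/\ uniq s, supported s (gr_comp ^~ x) & x = \sum_(g <- s) gr_comp g x].
Proof. by rewrite /gr_comp; case: cid => p [] /=. Qed.

Lemma gr_comp_eq s x (y : G -> V) : uniq s -> supported s y ->
  (forall g, D g (y g)) -> x = \sum_(g <- s) y g -> gr_comp ^~ x =1 y.
Proof.
move=> us sy Dy xE; have [t [ut tx xE']] := gr_comp_sum x.
apply: (gr_uniq ut us) => //; first by move=> g; exact: gr_comp_deg.
by rewrite -xE' -xE.
Qed.

Lemma gr_comp_linear g : linear (gr_comp g).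
Proof.
move=> a x y; have [s [us sx xE]] := gr_comp_sum x.
have [t [ut ty yE]] := gr_comp_sum y; set u := undup (s ++ t).
have uu : uniq u by exact: undup_uniq.
have su i : i \notin u -> i \notin s /\ i \notin t.
  by rewrite mem_undup mem_cat negb_or => /andP.
apply: (@gr_comp_eq u _ (fun i => a *: gr_comp i x + gr_comp i y)) => //.
- by move=> i /su[/sx -> /ty ->]; rewrite scaler0 addr0.
- by move=> i; apply: gr_degP; exact: gr_comp_deg.
- rewrite big_split /= -scaler_sumr (big_support uu us) //; last first.
    by move=> i /su[/sx].
  rewrite (big_support uu ut) //; last by move=> i /su[_ /ty].
  by rewrite -xE -yE.
Qed.

HB.instance Definition _ g :=
  GRing.isLinear.Build k V V _ (gr_comp g) (gr_comp_linear g).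

End Components.

Lemma gr_support (k : fieldType) (G : zmodType) (V : vectType k)
    (D : grading G V) :
  exists2 s : seq G, uniq s & forall v, supported s (gr_comp D ^~ v).
Proof.
have [f fP] := choice (gr_comp_sum D).
set b := vbasis (fullv : {vspace V}).
exists (undup (flatten [seq f x | x <- b])) => [|v g]; first exact: undup_uniq.
rewrite mem_undup => gs.
rewrite (coord_vbasis (memvf v)).
rewrite linear_sum big1 // => i _; rewrite linearZ /=.
have [_ fs _] := fP b`_i; rewrite fs ?scaler0 //.
apply: contra gs => gi; apply/flatten_mapP; exists b`_i => //.
by apply: mem_nth; rewrite size_tuple.
Qed.

HB.mixin Record isGModule (k : fieldType) (G : zmodType) (A : fdimAlgType k)
    (gr : alg_grading G A) M of Vector k M := {
  gm_act : A -> M -> M;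
  gm_act_linl : forall m, linear (fun a => gm_act a m);
  gm_act_linr : forall a, linear (gm_act a);
  gm_act1 : forall m, gm_act 1 m = m;
  gm_actM : forall a b m, gm_act (a * b) m = gm_act a (gm_act b m);
  gm_grading : grading G M;
  gm_act_deg : forall g h a m,
    gr g a -> gm_grading h m -> gm_grading (g + h) (gm_act a m)
}.

(* The objects of A-gmod.  This structure has its own universe: Nat(Id, Pi_g) *)
(* quantifies over all its carriers, so they cannot range over [vectType k],  *)
(* whose universe is too large for Nat(Id, Pi_g) to be a [zmodType].          *)
#[short(type="gmodule")]
HB.structure Definition GModule (k : fieldType) (G : zmodType)
    (A : fdimAlgType k) (gr : alg_grading G A) :=
  {M of Vector k M & isGModule k G A gr M}.

Arguments gm_grading {k G A gr} M : rename.

Section GradedModules.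
Variables (k : fieldType) (G : zmodType) (A : fdimAlgType k).
Variable gr : alg_grading G A.

Record gm_hom (M N : gmodule gr) := GmHom {
  gh_fun :> M -> N;
  gh_linear : linear gh_fun;
  gh_act : forall (a : A) m, gh_fun (gm_act a m) = gm_act a (gh_fun m);
  gh_deg : forall g m, gm_grading M g m -> gm_grading N g (gh_fun m)
}.

Program Definition shift_grading (g : G) (M : gmodule gr) : grading G M :=
  @Grading k G M (fun h => gm_grading M (h + g)) _ _ _ _.
Next Obligation. by move=> g M h; exact: gr_deg0. Qed.
Next Obligation. by move=> g M h a x y; exact: gr_degP. Qed.
Next Obligation.
move=> g M x; have [s [y [us Dy ->]]] := gr_span (gm_grading M) x.
exists [seq h - g | h <- s], (fun h => y (h + g)); split => //.
- by rewrite map_inj_uniq //; exact: addIr.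
- by rewrite big_map; apply: eq_bigr => h _; rewrite subrK.
Qed.
Next Obligation.
move=> g M s y us Dy s0 h hs.
have := @gr_free _ _ _ (gm_grading M) [seq h + g | h <- s]
  (fun h => y (h - g)) _ _ _ (h + g) _.
rewrite addrK; apply.
- by rewrite map_inj_uniq //; exact: addIr.
- by move=> h'; have := Dy (h' - g); rewrite subrK.
- by rewrite big_map -[RHS]s0; apply: eq_bigr => i _; rewrite addrK.
- exact: map_f.
Qed.

Fact shift_act_deg (g : G) (M : gmodule gr) u h (a : A) (m : M) :
  gr u a -> shift_grading g M h m -> shift_grading g M (u + h) (gm_act a m).
Proof. by move=> ua hm; rewrite /= -addrA; exact: gm_act_deg. Qed.

Definition shift_sort (g : G) (M : gmodule gr) : Type := M.

HB.instance Definition _ (g : G) (M : gmodule gr) :=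
  Vector.copy (shift_sort g M) (GModule.sort M).
HB.instance Definition _ (g : G) (M : gmodule gr) :=
  isGModule.Build k G A gr (shift_sort g M) (@gm_act_linl _ _ _ _ M)
    (@gm_act_linr _ _ _ _ M) (@gm_act1 _ _ _ _ M) (@gm_actM _ _ _ _ M)
    (@shift_act_deg g M).

Definition shift (g : G) (M : gmodule gr) : gmodule gr := shift_sort g M.

Lemma shift_degE (g h : G) (M : gmodule gr) :
  gm_grading (shift g M) h = gm_grading M (h + g).
Proof. by []. Qed.

Lemma shift_actE (g : G) (M : gmodule gr) :
  @gm_act _ _ _ _ (shift g M) = @gm_act _ _ _ _ M.
Proof. by []. Qed.

Program Definition shift_map (g : G) (M N : gmodule gr) (f : gm_hom M N) :
    gm_hom (shift g M) (shift g N) :=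
  @GmHom (shift g M) (shift g N) f (gh_linear f) (@gh_act _ _ f) _.
Next Obligation. by move=> g M N f h m hm; exact: (gh_deg f hm). Qed.

Program Definition gm_comp (L M N : gmodule gr) (f : gm_hom M N)
  (e : gm_hom L M) : gm_hom L N := @GmHom L N (f \o e) _ _ _.
Next Obligation. by move=> L M N f e a x y /=; rewrite !gh_linear. Qed.
Next Obligation. by move=> L M N f e a m /=; rewrite !gh_act. Qed.
Next Obligation. by move=> L M N f e g m /= gm; do 2!apply: gh_deg. Qed.

(* The equality Pi_k (Pi_h M) = Pi_(h + k) M, as the identity map.            *)
Program Definition shiftD (h k : G) (M : gmodule gr) :
    gm_hom (shift k (shift h M)) (shift (h + k) M) :=
  @GmHom (shift k (shift h M)) (shift (h + k) M) (fun m => m) _ _ _.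
Next Obligation. by []. Qed.
Next Obligation. by []. Qed.
Next Obligation.
move=> h i M g m.
change (gm_grading M (g + i + h) m -> gm_grading M (g + (h + i)) m).
by rewrite (addrC h) addrA.
Qed.

(* Nat(Id, Pi_g)                                                              *)
Record shift_nat (g : G) := ShiftNat {
  sn_hom :> forall M : gmodule gr, gm_hom M (shift g M);
  sn_natural : forall (M N : gmodule gr) (f : gm_hom M N),
    gm_comp (shift_map g f) (sn_hom M) =1 gm_comp (sn_hom N) f
}.


(* Pi_k(a) o b, for a in Nat(Id, Pi_h) and b in Nat(Id, Pi_k).               *)
Program Definition sn_mul (h k : G) (a : shift_nat h) (b : shift_nat k) :
    shift_nat (h + k) :=
  @ShiftNat (h + k)
    (fun M => gm_comp (shiftD h k M) (gm_comp (shift_map k (a M)) (b M))) _.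
Next Obligation.
move=> h i a b M N f m /=.
by have /= -> := sn_natural a f (b M m); have /= -> := sn_natural b f m.
Qed.

End GradedModules.

Section Gcentre.
Variables (k : fieldType) (G : zmodType) (A : fdimAlgType k).
Variable gr : alg_grading G A.

(* As A is finite dimensional, the algebra of all functions G -> A, with the  *)
(* pointwise operations, is A tensor k^G.                                     *)
Definition gcentre_pred : {pred G -> A} := [pred x : G -> A |
  `[< forall (g h : G) (y : A), gr h y -> x g * y = y * x (g + h) >]].

Record gcentre := Gcentre {
  gc_fun :> G -> A;
  gc_funP : gc_fun \in gcentre_pred
}.

Lemma gcentre_predP (x : G -> A) :
  reflect (forall g h y, gr h y -> x g * y = y * x (g + h))
    (x \in gcentre_pred).
Proof. exact: asboolP. Qed.

Lemma fdimalg_scaleAl (a : k) (x y : A) : a *: (x * y) = (a *: x) * y.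
Proof. exact: ua_scaleAl. Qed.

Lemma fdimalg_scaleAr (a : k) (x y : A) : a *: (x * y) = x * (a *: y).
Proof. exact: ua_scaleAr. Qed.

Fact gcentre_subring : subring_closed gcentre_pred.
Proof.
split=> [|x y /gcentre_predP Cx /gcentre_predP Cy
         |x y /gcentre_predP Cx /gcentre_predP Cy]; apply/gcentre_predP => g h z gz.
- by rewrite /= mul1r mulr1.
- by rewrite /= mulrBl mulrBr (Cx _ h) // (Cy _ h).
- by rewrite /= -mulrA (Cy _ h) // mulrA (Cx _ h) // mulrA.
Qed.

Fact gcentre_submod : submod_closed gcentre_pred.
Proof.
split=> [|a x y /gcentre_predP Cx /gcentre_predP Cy]; apply/gcentre_predP => g h z gz.
  by rewrite /= mul0r mulr0.
rewrite /= mulrDl mulrDr (Cy _ h) //; congr (_ + _).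
by rewrite -fdimalg_scaleAl (Cx _ h) // fdimalg_scaleAr.
Qed.

HB.instance Definition _ := GRing.isSubringClosed.Build _ gcentre_pred gcentre_subring.
HB.instance Definition _ := GRing.isSubmodClosed.Build _ _ gcentre_pred gcentre_submod.

HB.instance Definition _ := [isSub of gcentre for gc_fun].
HB.instance Definition _ := [Choice of gcentre by <:].
HB.instance Definition _ := [SubChoice_isSubZmodule of gcentre by <:].
HB.instance Definition _ := 
  GRing.SubZmodule_isSubPzRing.Build _ _ gcentre gcentre_subring.
HB.instance Definition _ := [SubZmodule_isSubLmodule of gcentre by <:].


Lemma gcentre_scaleAl (a : k) (x y : gcentre) : a *: (x * y) = (a *: x) * y.
Proof. by apply/val_inj/funext => g; exact: fdimalg_scaleAl. Qed.

Lemma gcentre_scaleAr (a : k) (x y : gcentre) : a *: (x * y) = x * (a *: y).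
Proof. by apply/val_inj/funext => g; exact: fdimalg_scaleAr. Qed.

(* The intersection of the G-centre with the functions G -> A_g.             *)
Definition gcentre_deg (g : G) : set gcentre := [set x | forall h, gr g (x h)].

Lemma gcentre_sumE (s : seq G) (y : G -> gcentre) (h : G) :
  (\sum_(g <- s) y g : gcentre) h = \sum_(g <- s) y g h.
Proof. by elim/big_rec2: _ => //= g u v _ <-. Qed.

Fact gr_comp_gcentre (u : G) (x : gcentre) :
  (fun h => gr_comp gr u (x h)) \in gcentre_pred.
Proof.
apply/gcentre_predP => g h y hy.
have [s us sP] := gr_support gr.
have /gcentre_predP/(_ g h y hy) xy := gc_funP x.
have xs z : z = \sum_(i <- s) gr_comp gr i z.
  have [t [ut tz zE]] := gr_comp_sum gr z.
  by rewrite {1}zE; apply: big_support => //; exact: sP.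
pose s' := [seq i + h | i <- s].
have us' : uniq s' by rewrite map_inj_uniq //; exact: addIr.
pose F i := gr_comp gr (i - h) (x g) * y.
pose F' i := y * gr_comp gr (i - h) (x (g + h)).
have := @gr_uniq _ _ _ gr s' s' F F' us' us' _ _ _ _ _ (u + h).
rewrite /F /F' addrK; apply.
- move=> i is'; rewrite sP ?mul0r //; apply: contra is' => /(map_f (+%R^~ h)).
  by rewrite subrK.
- move=> i is'; rewrite sP ?mulr0 //; apply: contra is' => /(map_f (+%R^~ h)).
  by rewrite subrK.
- by move=> i; rewrite -{1}(subrK h i); apply: ag_mul => //; exact: gr_comp_deg.
- move=> i; rewrite -{1}(subrK h i) addrC; apply: ag_mul => //.
  exact: gr_comp_deg.
- rewrite !big_map; under eq_bigr do rewrite addrK.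
  under [RHS]eq_bigr do rewrite addrK.
  by rewrite -mulr_suml -mulr_sumr -!xs.
Qed.

Program Definition gcentre_grading : grading G gcentre :=
  @Grading k G gcentre gcentre_deg _ _ _ _.
Next Obligation. by move=> g h; exact: gr_deg0. Qed.
Next Obligation. by move=> g a x y gx gy h; exact: gr_degP. Qed.
Next Obligation.
move=> x; have [s us sP] := gr_support gr.
exists s, (fun u => Gcentre (gr_comp_gcentre u x)); split => //.
  by move=> g h; exact: gr_comp_deg.
apply/val_inj/funext => h; rewrite /= gcentre_sumE /=.
have [t [ut tz xE]] := gr_comp_sum gr (x h).
by rewrite {1}xE; apply: big_support => //; exact: sP.
Qed.
Next Obligation.
move=> s y us Dy y0 g gs; apply/val_inj/funext => h /=.
apply: (@gr_free _ _ _ gr s (fun g => y g h)) => //.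
  by move=> i; exact: Dy.
by rewrite -gcentre_sumE y0.
Qed.

Lemma gcentre_deg_mul (g h : G) (x y : gcentre) :
  gcentre_grading g x -> gcentre_grading h y -> gcentre_grading (g + h) (x * y).
Proof. by move=> gx hy i; exact: ag_mul. Qed.

End Gcentre.

Section EndPi.
Variables (k : fieldType) (G : zmodType) (A : fdimAlgType k).
Variable gr : alg_grading G A.
Implicit Types (g h : G) (M N : gmodule gr).

Lemma shift_nat_eq g (a b : shift_nat gr g) :
  (forall M (m : M), a M m = b M m) -> a = b.
Proof.
have gm_hom_eq M N (e f : gm_hom M N) : e =1 f -> e = f.
  case: e f => [e e1 e2 e3] [f f1 f2 f3] /= /funext ef; case: _ / ef in f1 f2 f3 *.
  by congr GmHom; exact: Prop_irrelevance.
case: a b => [a an] [b bn] /= ab.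
have {}ab : a = b by apply: functional_extensionality_dep => M; exact/gm_hom_eq/ab.
by case: _ / ab in bn *; congr ShiftNat; exact: Prop_irrelevance.
Qed.

Definition is_shift_nat g (F : forall M, M -> M) : Prop :=
  [/\ forall M, linear (F M),
      forall M a (m : M), F M (gm_act a m) = gm_act a (F M m),
      forall M h m, gm_grading M h m -> gm_grading M (h + g) (F M m) &
      forall M N (f : gm_hom M N) m, f (F M m) = F N (f m)].

Lemma shift_natP g (a : shift_nat gr g) : is_shift_nat g (fun M => a M).
Proof.
split=> [M|M|M|M N f m]; first exact: (gh_linear (a M)).
- by move=> u m; have /= -> := gh_act (a M) u m.
- by move=> h m; exact: (@gh_deg _ _ _ _ _ _ (a M)).
- exact: (sn_natural a f).
Qed.

Section MkShiftNat.
Variables (g : G) (F : forall M : gmodule gr, M -> M).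
Hypothesis FP : is_shift_nat g F.

Program Definition mk_shift_nat : shift_nat gr g :=
  @ShiftNat k G A gr g (fun M => @GmHom k G A gr M (shift g M) (@F M) _ _ _) _.
Next Obligation. by have [+ _ _ _] := FP; apply. Qed.
Next Obligation. by have [_ + _ _] := FP; apply. Qed.
Next Obligation. by have [_ _ + _] := FP; apply. Qed.
Next Obligation. by have [_ _ _ +] := FP; move=> H M N f m /=; rewrite H. Qed.

End MkShiftNat.

Lemma is_shift_nat0 g : is_shift_nat g (fun M _ => 0 : M).
Proof.
split=> [M a x y|M a m|M h m _|M N f m]; first by rewrite scaler0 addr0.
- exact/esym/(linear0 (HB.pack_for {linear M -> M} (gm_act a)
    (GRing.isLinear.Build k M M _ (gm_act a) (gm_act_linr a)))).
- exact: gr_deg0.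
- exact: (linear0 (HB.pack_for {linear M -> N} (gh_fun f)
    (GRing.isLinear.Build k M N _ (gh_fun f) (gh_linear f)))).
Qed.

Lemma is_shift_natP g (c : k) (F F' : forall M, M -> M) :
  is_shift_nat g F -> is_shift_nat g F' ->
  is_shift_nat g (fun M m => c *: F M m + F' M m).
Proof.
move=> [Fl Fa Fd Fn] [F'l F'a F'd F'n].
split=> [M a x y|M a m|M h m hm|M N f m].
- rewrite Fl F'l !scalerDr !scalerA (mulrC c) -!addrA; congr (_ + _).
  by rewrite addrCA.
- by rewrite Fa F'a gm_act_linr.
- by apply: gr_degP; [exact: Fd | exact: F'd].
- by rewrite gh_linear Fn F'n.
Qed.

Lemma is_shift_nat_sum g (I : Type) (s : seq I) (F : I -> forall M, M -> M) :
  (forall i, is_shift_nat g (F i)) ->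
  is_shift_nat g (fun M m => \sum_(i <- s) F i M m).
Proof.
move=> FP; elim: s => [|i s IH].
  rewrite (_ : (fun _ => _) = fun M _ => 0); first exact: is_shift_nat0.
  by apply: functional_extensionality_dep => M; apply/funext => m; rewrite big_nil.
rewrite (_ : (fun _ => _) = fun M m => 1 *: F i M m + \sum_(i <- s) F i M m).
  exact: is_shift_natP.
apply: functional_extensionality_dep => M; apply/funext => m.
by rewrite big_cons scale1r.
Qed.

Lemma is_shift_nat_id : is_shift_nat 0 (fun M m => m).
Proof. by split=> // M h m; rewrite addr0. Qed.

Definition sn0 g := mk_shift_nat (is_shift_nat0 g).
(* c *: a + b *)
Definition sn_comb g (c : k) (a b : shift_nat gr g) :=
  mk_shift_nat (is_shift_natP c (shift_natP a) (shift_natP b)).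
Definition sn1 := mk_shift_nat is_shift_nat_id.

(* The direct sum of the Nat(Id, Pi_g): finitely supported families.          *)
Record EndPi := MkEndPi {
  ep_comp :> forall g, shift_nat gr g;
  ep_fin : exists s : seq G, forall g, g \notin s -> ep_comp g = sn0 g
}.

HB.instance Definition _ := gen_eqMixin EndPi.
HB.instance Definition _ := gen_choiceMixin EndPi.

Lemma EndPi_eq (a b : EndPi) : (forall g M (m : M), a g M m = b g M m) -> a = b.
Proof.
case: a b => [a afin] [b bfin] /= ab.
have {}ab : a = b.
  by apply: functional_extensionality_dep => g; exact/shift_nat_eq/ab.
by case: _ / ab in bfin *; congr MkEndPi; exact: Prop_irrelevance.
Qed.

Lemma ep_supp (a : EndPi) : exists2 s, uniq s &
  forall g, g \notin s -> forall M (m : M), a g M m = 0.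
Proof.
have [s sP] := ep_fin a; exists (undup s) => [|g]; first exact: undup_uniq.
by rewrite mem_undup => /sP ->.
Qed.

Fact ep_comb_fin (c : k) (a b : EndPi) :
  exists s : seq G, forall g, g \notin s -> sn_comb c (a g) (b g) = sn0 g.
Proof.
have [s sP] := ep_fin a; have [t tP] := ep_fin b.
exists (s ++ t) => g; rewrite mem_cat negb_or => /andP[/sP -> /tP ->].
by apply: shift_nat_eq => M m /=; rewrite scaler0 addr0.
Qed.

Definition ep_comb (c : k) (a b : EndPi) : EndPi := MkEndPi (ep_comb_fin c a b).

Fact ep0_fin : exists s : seq G, forall g, g \notin s -> sn0 g = sn0 g.
Proof. by exists [::]. Qed.

Definition ep0 : EndPi := MkEndPi ep0_fin.

Definition ep_add (a b : EndPi) := ep_comb 1 a b.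
Definition ep_opp (a : EndPi) := ep_comb (- 1) a ep0.
Definition ep_scale (c : k) (a : EndPi) := ep_comb c a ep0.

Lemma ep_combE c a b g M (m : M) : ep_comb c a b g M m = c *: a g M m + b g M m.
Proof. by []. Qed.

Lemma ep_addE a b g M (m : M) : ep_add a b g M m = a g M m + b g M m.
Proof. by rewrite ep_combE scale1r. Qed.

Lemma ep_oppE a g M (m : M) : ep_opp a g M m = - a g M m.
Proof. by rewrite ep_combE scaleN1r addr0. Qed.

Lemma ep_scaleE c a g M (m : M) : ep_scale c a g M m = c *: a g M m.
Proof. by rewrite ep_combE addr0. Qed.

Fact ep_addA : associative ep_add.
Proof. by move=> a b c; apply: EndPi_eq => g M m; rewrite !ep_addE addrA. Qed.
Fact ep_addC : commutative ep_add.
Proof. by move=> a b; apply: EndPi_eq => g M m; rewrite !ep_addE addrC. Qed.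
Fact ep_add0 : left_id ep0 ep_add.
Proof. by move=> a; apply: EndPi_eq => g M m; rewrite !ep_addE add0r. Qed.
Fact ep_addN : left_inverse ep0 ep_opp ep_add.
Proof.
by move=> a; apply: EndPi_eq => g M m; rewrite ep_addE ep_oppE addNr.
Qed.

HB.instance Definition _ :=
  GRing.isZmodule.Build EndPi ep_addA ep_addC ep_add0 ep_addN.

Fact ep_scaleA (c d : k) a : ep_scale c (ep_scale d a) = ep_scale (c * d) a.
Proof. by apply: EndPi_eq => g M m; rewrite !ep_scaleE scalerA. Qed.
Fact ep_scale1 : left_id 1 ep_scale.
Proof. by move=> a; apply: EndPi_eq => g M m; rewrite ep_scaleE scale1r. Qed.
Fact ep_scaleDr : right_distributive ep_scale +%R.
Proof.
by move=> c a b; apply: EndPi_eq => g M m; rewrite !(ep_scaleE, ep_addE) scalerDr.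
Qed.
Fact ep_scaleDl a : {morph ep_scale^~ a : c d / c + d}.
Proof.
by move=> c d; apply: EndPi_eq => g M m; rewrite !(ep_scaleE, ep_addE) scalerDl.
Qed.

HB.instance Definition _ :=
  GRing.Zmodule_isLmodule.Build k EndPi ep_scaleA ep_scale1 ep_scaleDr ep_scaleDl.

(* The degree g component of a product is the sum over h of                   *)
(*   (a h) (b (g - h)) in Nat(Id, Pi_(h + (g - h))) = Nat(Id, Pi_g).          *)
Definition ep_mul_comp (a b : EndPi) (g : G) M (m : M) : M :=
  \sum_(h \in [set: G]) (sn_mul (a h) (b (g - h)) M m : M).

Lemma sn_mulE g h (a : shift_nat gr g) (b : shift_nat gr h) M (m : M) :
  sn_mul a b M m = a M (b M m).
Proof. by []. Qed.

Lemma sn_lin0 g (a : shift_nat gr g) M : a M (0 : M) = 0.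
Proof. by have := gh_linear (a M) (- 1) 0 0; rewrite !scaler0 addr0 scaleN1r addNr. Qed.

Lemma sn_linD g (a : shift_nat gr g) M (m n : M) : a M (m + n) = a M m + a M n.
Proof. by have := gh_linear (a M) 1 m n; rewrite !scale1r. Qed.

Lemma sn_linZ g (a : shift_nat gr g) M (c : k) (m : M) : a M (c *: m) = c *: a M m.
Proof. by have := gh_linear (a M) c m 0; rewrite sn_lin0 !addr0. Qed.

Lemma sn_lin_sum g (a : shift_nat gr g) M (I : Type) (s : seq I) (F : I -> M) :
  a M (\sum_(i <- s) F i) = \sum_(i <- s) (a M (F i) : M).
Proof.
elim: s => [|i s IH]; first by rewrite !big_nil sn_lin0.
by rewrite !big_cons sn_linD IH.
Qed.

Lemma ep_mul_compE (a b : EndPi) (s : seq G) : uniq s ->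
  (forall h, h \notin s -> forall M (m : M), a h M m = 0) ->
  forall g M (m : M), ep_mul_comp a b g m = \sum_(h <- s) (a h M (b (g - h) M m) : M).
Proof. by move=> us sP g M m; apply: fsum_seq => // h hs; exact: sP. Qed.

Lemma is_shift_nat_cast g h (F : forall M, M -> M) :
  g = h -> is_shift_nat g F -> is_shift_nat h F.
Proof. by move=> ->. Qed.

Fact is_shift_nat_mul (a b : EndPi) g :
  is_shift_nat g (fun M (m : M) => ep_mul_comp a b g m).
Proof.
have [s us sP] := ep_supp a.
rewrite (_ : (fun _ => _) =
    fun M (m : M) => \sum_(h <- s) (sn_mul (a h) (b (g - h)) M m : M)).
  apply: is_shift_nat_sum => h.
  apply: is_shift_nat_cast (shift_natP (sn_mul (a h) (b (g - h)))).
  by rewrite addrC subrK.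
apply: functional_extensionality_dep => M; apply/funext => m.
exact: ep_mul_compE.
Qed.

Definition ep_mul_nat (a b : EndPi) g := mk_shift_nat (is_shift_nat_mul a b g).

Fact ep_mul_fin (a b : EndPi) :
  exists s : seq G, forall g, g \notin s -> ep_mul_nat a b g = sn0 g.
Proof.
have [s us sP] := ep_supp a; have [t ut tP] := ep_supp b.
exists [seq h + i | h <- s, i <- t] => g gst; apply: shift_nat_eq => M m.
rewrite /= (ep_mul_compE _ us sP) big_seq big1 // => h hs.
rewrite tP ?sn_lin0 //; apply: contra gst => gt.
by apply/allpairsP; exists (h, g - h); split => //=; rewrite addrC subrK.
Qed.

Definition ep_mul (a b : EndPi) : EndPi := MkEndPi (ep_mul_fin a b).

Lemma ep_mulE (a b : EndPi) (s : seq G) : uniq s ->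
  (forall h, h \notin s -> forall M (m : M), a h M m = 0) ->
  forall g M (m : M), ep_mul a b g M m = \sum_(h <- s) (a h M (b (g - h) M m) : M).
Proof. exact: ep_mul_compE. Qed.

(* The identity of Id = Pi_0, placed in degree 0.                             *)
Definition ep_one_nat (g : G) : shift_nat gr g :=
  if 0 =P g is ReflectT e then eq_rect 0 (@shift_nat k G A gr) sn1 g e else sn0 g.

Fact ep_one_fin : exists s : seq G, forall g, g \notin s -> ep_one_nat g = sn0 g.
Proof.
exists [:: 0] => g; rewrite inE /ep_one_nat; case: eqP => // e.
by case: _ / e; rewrite eqxx.
Qed.

Definition ep_one : EndPi := MkEndPi ep_one_fin.

Lemma ep_oneE g M (m : M) : ep_one g M m = if g == 0 then m else 0.
Proof.
rewrite /= /ep_one_nat; case: eqP => [e|/eqP]; last by rewrite eq_sym => /negbTE ->.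
by case: _ / e; rewrite eqxx.
Qed.

Fact ep_mulA : associative ep_mul.
Proof.
move=> a b c; apply: EndPi_eq => g M m.
have [s us sP] := ep_supp a; have [t ut tP] := ep_supp b.
pose u := undup [seq h + i | h <- s, i <- t].
have uu : uniq u by exact: undup_uniq.
have uP h : h \notin u -> forall M (m : M), ep_mul a b h M m = 0.
  rewrite mem_undup => hst N n.
  rewrite (ep_mulE _ us sP) big_seq big1 // => i si.
  rewrite tP ?sn_lin0 //; apply: contra hst => ht.
  by apply/allpairsP; exists (i, h - i); split => //=; rewrite addrC subrK.
rewrite (ep_mulE _ us sP) (ep_mulE _ uu uP).
under [RHS]eq_bigr do rewrite (ep_mulE _ us sP).
rewrite exchange_big /=; apply: eq_big_seq => h hs.
rewrite (ep_mul_compE _ ut tP) -sn_lin_sum; congr (a h M _).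
transitivity (\sum_(i <- [seq i + h | i <- t])
    (b (i - h) M (c (g - i) M m) : M)).
  rewrite big_map; apply: eq_bigr => i _; rewrite addrK.
  by rewrite opprD addrCA addrA addrC addrA addrAC [- h + g]addrC.
apply: big_support => // [|i ih|i iu].
- by rewrite map_inj_uniq //; exact: addIr.
- rewrite tP //; apply: contra ih => ih; apply/mapP; exists (i - h) => //.
  by rewrite subrK.
- rewrite tP //; apply: contra iu => ih; rewrite mem_undup; apply/allpairsP.
  by exists (h, i - h); split => //=; rewrite addrC subrK.
Qed.

Fact ep_mul1l : left_id ep_one ep_mul.
Proof.
move=> a; apply: EndPi_eq => g M m; rewrite (@ep_mulE _ _ [:: 0]) //.
  by rewrite big_seq1 ep_oneE eqxx subr0.
by move=> h; rewrite inE => /negbTE h0 N n; rewrite ep_oneE h0.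
Qed.

Fact ep_mul1r : right_id ep_one ep_mul.
Proof.
move=> a; apply: EndPi_eq => g M m; have [s us sP] := ep_supp a.
rewrite (ep_mulE _ us sP).
under eq_bigr => h _.
  rewrite ep_oneE (_ : a h M _ = if h == g then a h M m : M else 0); first over.
  by rewrite subr_eq0 eq_sym; case: eqP => // _; rewrite sn_lin0.
rewrite -big_mkcond -big_filter.
have [gs|gs] := boolP (g \in s); last first.
  by rewrite sP // big_filter big_seq_cond big1 // => h /andP[hs /eqP hg];
    rewrite hg in hs; rewrite hs in gs.
by rewrite (filter_pred1_uniq us gs) big_seq1.
Qed.

Fact ep_mulDl : left_distributive ep_mul +%R.
Proof.
move=> a b c; apply: EndPi_eq => g M m.
have [s us sP] := ep_supp a; have [t ut tP] := ep_supp b.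
have uu : uniq (undup (s ++ t)) by exact: undup_uniq.
have su h : h \notin undup (s ++ t) -> h \notin s /\ h \notin t.
  by rewrite mem_undup mem_cat negb_or => /andP.
rewrite ep_addE !(@ep_mulE _ _ (undup (s ++ t))) // => [|h /su[_ /tP] //||].
- by rewrite -big_split; apply: eq_bigr => h _; rewrite ep_addE.
- by move=> h /su[/sP].
- by move=> h /su[/sP sh /tP th] N n; rewrite ep_addE sh th addr0.
Qed.

Fact ep_mulDr : right_distributive ep_mul +%R.
Proof.
move=> a b c; apply: EndPi_eq => g M m; have [s us sP] := ep_supp a.
rewrite ep_addE !(ep_mulE _ us sP) -big_split; apply: eq_bigr => h _.
by rewrite ep_addE sn_linD.
Qed.

HB.instance Definition _ := GRing.Zmodule_isPzRing.Build EndPi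
  ep_mulA ep_mul1l ep_mul1r ep_mulDl ep_mulDr.

Lemma EndPi_scaleAl (c : k) (a b : EndPi) : c *: (a * b) = (c *: a) * b.
Proof.
apply: EndPi_eq => g M m; have [s us sP] := ep_supp a.
rewrite ep_scaleE !(ep_mulE _ us) // => [|h /sP sh N n].
  by rewrite scaler_sumr; apply: eq_bigr => h _; rewrite ep_scaleE.
by rewrite ep_scaleE sh scaler0.
Qed.

Lemma EndPi_scaleAr (c : k) (a b : EndPi) : c *: (a * b) = a * (c *: b).
Proof.
apply: EndPi_eq => g M m; have [s us sP] := ep_supp a.
rewrite ep_scaleE !(ep_mulE _ us sP) scaler_sumr; apply: eq_bigr => h _.
by rewrite ep_scaleE sn_linZ.
Qed.

Definition EndPi_deg (g : G) : set EndPi :=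
  [set a | forall h, h != g -> a h = sn0 h].

Lemma EndPi_sumE (I : Type) (s : seq I) (y : I -> EndPi) g M (m : M) :
  (\sum_(i <- s) y i) g M m = \sum_(i <- s) (y i g M m : M).
Proof.
elim: s => [|i s IH]; first by rewrite !big_nil.
by rewrite !big_cons ep_addE IH.
Qed.

Definition ep_proj_nat (a : EndPi) (g h : G) : shift_nat gr h :=
  if h == g then a h else sn0 h.

Fact ep_proj_fin (a : EndPi) g :
  exists s : seq G, forall h, h \notin s -> ep_proj_nat a g h = sn0 h.
Proof.
by exists [:: g] => h; rewrite inE /ep_proj_nat => /negbTE ->.
Qed.

Definition ep_proj (a : EndPi) g : EndPi := MkEndPi (ep_proj_fin a g).

Program Definition EndPi_grading : grading G EndPi :=
  @Grading k G EndPi EndPi_deg _ _ _ _.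
Next Obligation. by []. Qed.
Next Obligation.
move=> g c a b ga gb h hg; apply: shift_nat_eq => M m.
by rewrite ep_addE ep_scaleE ga // gb //= scaler0 addr0.
Qed.
Next Obligation.
move=> a; have [s us sP] := ep_supp a; exists s, (ep_proj a); split => //.
  by move=> g h; rewrite /= /ep_proj_nat => /negbTE ->.
apply: EndPi_eq => h M m; rewrite EndPi_sumE /= /ep_proj_nat.
have [hs|hs] := boolP (h \in s); last first.
  by rewrite sP // big1 // => g _; case: ifP => // _; rewrite sP.
rewrite (bigD1_seq h) //= eqxx big1 ?addr0 // => g /negbTE.
by rewrite eq_sym => ->.
Qed.
Next Obligation.
move=> s y us Dy y0 g gs; apply: EndPi_eq => h M m.
have [->|hg] := eqVneq h g; last by rewrite Dy.
have := EndPi_sumE s y g m; rewrite y0 (bigD1_seq g) //= big1 ?addr0 // => i ig.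
by rewrite Dy // eq_sym.
Qed.

Lemma EndPi_deg_mul g h (a b : EndPi) :
  EndPi_grading g a -> EndPi_grading h b -> EndPi_grading (g + h) (a * b).
Proof.
move=> ga hb i igh; apply: shift_nat_eq => M m.
rewrite (@ep_mulE _ _ [:: g]) // => [|j]; last first.
  by rewrite inE => jg N n; rewrite ga.
rewrite big_seq1 hb ?sn_lin0 //.
by apply: contra igh => /eqP <-; rewrite addrC subrK.
Qed.

End EndPi.

(* Main.v *)
(* An element x of the G-centre, of degree u, acts on a homogeneous m of degree
   g by x^(-g) m; the centrality relation says exactly that this commutes with
   the action of A, so it is a natural transformation Id -> Pi_u, and that
   composing two of these reverses the product.  Conversely, a natural
   transformation is determined by its values at the elements 1 of the shifts
   Pi_g A, since a homogeneous m of degree g is the image of 1 under the map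
   Pi_(-g) A -> M, a |-> a m.  Naturality with respect to right multiplication
   by y in A_h, which is a map Pi_g A -> Pi_(g + h) A, gives the centrality of
   these values. *)

Require Import Defs.
From HB Require Import structures.
From mathcomp Require Import all_boot all_order all_algebra.
From mathcomp Require Import finmap all_classical.

Set Implicit Arguments.
Unset Strict Implicit.
Unset Printing Implicit Defensive.

Import GRing.Theory.
Local Open Scope ring_scope.

(** * Homogeneous elements and components of graded spaces *)

Section GradedSpaces.
Variables (k : fieldType) (G : zmodType) (V : lmodType k) (D : grading G V).

Lemma gr_ind (P : V -> Prop) :
  (forall g x, D g x -> P x) -> (forall x y, P x -> P y -> P (x + y)) ->
  forall x, P x.
Proof.
move=> Phom PD x; have [s [y [_ Dy ->]]] := gr_span D x.
(* The empty sum needs no case of its own, since 0 is homogeneous of degree 0. *)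
elim: s => [|g s IH]; first by rewrite big_nil; apply/(Phom 0)/gr_deg0.
by rewrite big_cons; apply: PD => //; exact: Phom.
Qed.

Lemma gr_comp_hom g x : D g x ->
  gr_comp D ^~ x =1 fun h => if h == g then x else 0.
Proof.
move=> gx; apply: (@gr_comp_eq _ _ _ _ [:: g]) => //.
- by move=> h; rewrite inE => /negbTE ->.
- by move=> h; case: eqP => [->//|_]; exact: gr_deg0.
- by rewrite big_seq1 eqxx.
Qed.

End GradedSpaces.

(** * A finite list of degrees common to all vectors *)

Section VectSupport.
Variables (k : fieldType) (G : zmodType) (V : vectType k) (D : grading G V).

Definition gr_supp : seq G := s2val (cid2 (gr_support D)).

Lemma gr_supp_uniq : uniq gr_supp.
Proof. by rewrite /gr_supp; case: cid2. Qed.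

Lemma gr_comp_supp g v : g \notin gr_supp -> gr_comp D g v = 0.
Proof. by rewrite /gr_supp; case: cid2 => s /= _ sP /sP; apply. Qed.

Lemma gr_supp_sum v : v = \sum_(g <- gr_supp) gr_comp D g v.
Proof.
have [s [us sv {1}->]] := gr_comp_sum D v.
by apply: big_support => // [|g]; [exact: gr_supp_uniq | exact: gr_comp_supp].
Qed.

End VectSupport.

(** * Graded algebras and the regular module *)

Section GradedAlgebra.
Variables (k : fieldType) (G : zmodType) (A : fdimAlgType k).
Variable gr : alg_grading G A.

Lemma gr_comp_mulr g h (a b : A) :
  gr h b -> gr_comp gr g (a * b) = gr_comp gr (g - h) a * b.
Proof.
move=> hb; elim/(gr_ind (D := gr)): a => [i a ia|a a' IH IH'].
  rewrite (gr_comp_hom (ag_mul ia hb)) (gr_comp_hom ia) subr_eq.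
  by case: eqP => // _; rewrite mul0r.
by rewrite mulrDl !linearD /= mulrDl IH IH'.
Qed.

Lemma gr_comp_mul g (a b : A) :
  gr_comp gr g (a * b) =
  \sum_(h <- gr_supp gr) gr_comp gr (g - h) a * gr_comp gr h b.
Proof.
rewrite {1}(gr_supp_sum gr b) mulr_sumr linear_sum /=.
by apply: eq_bigr => h _; rewrite (@gr_comp_mulr _ h) //; exact: gr_comp_deg.
Qed.

(** Taking degree h components in 1 * b = b, for b in A_h, shows that the degree 0 component of 1 is
    a left identity, hence equals 1. *)
Lemma gr_one : gr 0 1.
Proof.
suff e1 b : gr_comp gr 0 1 * b = b by rewrite -(e1 1) mulr1; exact: gr_comp_deg.
elim/(gr_ind (D := gr)): b => [h b hb|b b' IH IH']; last by rewrite mulrDr IH IH'.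
by have := gr_comp_mulr h 1 hb; rewrite mul1r subrr (gr_comp_hom hb) eqxx.
Qed.

Definition regular_sort : Type := A.

HB.instance Definition _ := Vector.copy regular_sort (FdimAlg.sort A).

Fact mul_linl (m : A) : linear (fun a : A => a * m).
Proof. by move=> c a b; rewrite mulrDl fdimalg_scaleAl. Qed.

Fact mul_linr (a : A) : linear (fun m : A => a * m).
Proof. by move=> c m n; rewrite mulrDr fdimalg_scaleAr. Qed.

HB.instance Definition _ := isGModule.Build k G A gr regular_sort
  mul_linl mul_linr (@mul1r A) (fun a b m => esym (mulrA a b m))
  (ag_mul (a := gr)).

Definition regular : gmodule gr := regular_sort.

End GradedAlgebra.

(** * Graded modules and maps out of shifts of the regular module *)

Section GradedModule.
Variables (k : fieldType) (G : zmodType) (A : fdimAlgType k).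
Variables (gr : alg_grading G A).
Implicit Types M N : gmodule gr.

Lemma gm_actDl M (a b : A) (m : M) : gm_act (a + b) m = gm_act a m + gm_act b m.
Proof. by have := gm_act_linl m 1 a b; rewrite !scale1r. Qed.

Lemma gm_actDr M (a : A) (m n : M) : gm_act a (m + n) = gm_act a m + gm_act a n.
Proof. by have := gm_act_linr a 1 m n; rewrite !scale1r. Qed.

Lemma gm_act0l M (m : M) : gm_act 0 m = 0.
Proof. by apply: (addIr (gm_act 0 m)); rewrite -gm_actDl !add0r. Qed.

Lemma gm_act0r M (a : A) : gm_act a (0 : M) = 0.
Proof. by apply: (addIr (gm_act a 0)); rewrite -gm_actDr !add0r. Qed.

Lemma gm_act_suml M (I : Type) (s : seq I) (F : I -> A) (m : M) :
  gm_act (\sum_(i <- s) F i) m = \sum_(i <- s) (gm_act (F i) m : M).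
Proof.
elim: s => [|i s IH]; first by rewrite !big_nil gm_act0l.
by rewrite !big_cons gm_actDl IH.
Qed.

Lemma gh_funD M N (f : gm_hom M N) m n : f (m + n) = f m + f n.
Proof. by have := gh_linear f 1 m n; rewrite !scale1r. Qed.

Fact orbit_map_deg M g (m : M) : gm_grading M g m ->
  forall h a, gm_grading (shift (- g) (regular gr)) h a ->
  gm_grading M h (gm_act (a : A) m).
Proof.
move=> gm h a ha; rewrite -[h](subrK g); exact: gm_act_deg.
Qed.

Definition orbit_map M g (m : M) (gm : gm_grading M g m) :
    gm_hom (shift (- g) (regular gr)) M :=
  @GmHom _ _ _ _ (shift (- g) (regular gr)) M (fun a : A => gm_act a m)
    (gm_act_linl m) (fun a b => gm_actM a b m) (orbit_map_deg gm).

Fact rmul_map_deg g h (y : A) : gr h y ->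
  forall i a, gm_grading (shift g (regular gr)) i a ->
  gm_grading (shift (g + h) (regular gr)) i ((a : A) * y).
Proof. by move=> hy i a ia; rewrite shift_degE addrA; exact: ag_mul. Qed.

Definition rmul_map g h (y : A) (hy : gr h y) :
    gm_hom (shift g (regular gr)) (shift (g + h) (regular gr)) :=
  @GmHom _ _ _ _ (shift g (regular gr)) (shift (g + h) (regular gr))
    (fun a : A => a * y) (mul_linl y) (fun a b => esym (mulrA a b y))
    (rmul_map_deg hy).

(** * The map from the G-centre to End(Pi) *)

(* The index is [- g] because [x g * y = y * x (g + h)] raises it by the degree
   of [y] when moving to the right, while acting by [y] raises the degree of
   [m]. *)
Definition gcentre_act (x : G -> A) (u : G) M (m : M) : M :=
  \sum_(g <- gr_supp (gm_grading M))
    gm_act (gr_comp gr u (x (- g))) (gr_comp (gm_grading M) g m).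

Lemma gcentre_act_hom x u M g (m : M) : gm_grading M g m ->
  gcentre_act x u m = gm_act (gr_comp gr u (x (- g))) m.
Proof.
move=> gm; rewrite /gcentre_act.
under eq_bigr => h _ do rewrite (gr_comp_hom gm).
(* The degree g may be missing from [gr_supp]; then m = 0 and both sides vanish. *)
rewrite (@big_support _ _ _ [:: g]) ?gr_supp_uniq // => [|h hs|h].
- by rewrite big_seq1 eqxx.
- by have /= <- := gr_comp_hom gm h; rewrite (gr_comp_supp m hs) gm_act0r.
- by rewrite inE => /negbTE ->; rewrite gm_act0r.
Qed.

Lemma gcentre_act_linear x u M : linear (@gcentre_act x u M).
Proof.
move=> c m n; rewrite /gcentre_act scaler_sumr -big_split.
by apply: eq_bigr => g _; rewrite linearP gm_act_linr.
Qed.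

Lemma gcentre_actD x u M (m n : M) :
  gcentre_act x u (m + n) = gcentre_act x u m + gcentre_act x u n.
Proof. by have := gcentre_act_linear x u 1 m n; rewrite !scale1r. Qed.

Lemma is_shift_nat_gcentre (x : gcentre gr) u :
  is_shift_nat u (gcentre_act x u).
Proof.
split=> [M|M a m|M h m hm|M N f m]; first exact: gcentre_act_linear.
- elim/(gr_ind (D := gm_grading M)): m => [g m gm|m n IHm IHn]; last first.
    by rewrite gm_actDr !gcentre_actD IHm IHn gm_actDr.
  elim/(gr_ind (D := gr)): a => [h a ha|a b IHa IHb]; last first.
    by rewrite !gm_actDl gcentre_actD IHa IHb.
  have ham : gm_grading M (h + g) (gm_act a m) by exact: gm_act_deg.
  rewrite (gcentre_act_hom _ _ ham) (gcentre_act_hom _ _ gm).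
  (* The degree u component of x is again central, so x_u(-(h + g)) a = a x_u(-(h + g) + h) = a
     x_u(-g). *)
  have /gcentre_predP xa := gr_comp_gcentre u x.
  by rewrite -!gm_actM (xa _ _ _ ha) opprD addrAC addNr add0r.
- rewrite (gcentre_act_hom _ _ hm) addrC; apply: gm_act_deg => //.
  exact: gr_comp_deg.
- elim/(gr_ind (D := gm_grading M)): m => [g m gm|m n IHm IHn]; last first.
    by rewrite gcentre_actD !gh_funD gcentre_actD IHm IHn.
  by rewrite (gcentre_act_hom _ _ gm) (gcentre_act_hom _ _ (gh_deg f gm)) gh_act.
Qed.

Definition gcentre_nat (x : gcentre gr) u := mk_shift_nat (is_shift_nat_gcentre x u).

Fact gcentre_nat_fin (x : gcentre gr) :
  exists s : seq G, forall u, u \notin s -> gcentre_nat x u = sn0 gr u.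
Proof.
(* As A is finite dimensional, this list serves for all the values of x at once. *)
exists (gr_supp gr) => u us; apply: shift_nat_eq => M m /=.
by rewrite /gcentre_act big1 // => g _; rewrite gr_comp_supp // gm_act0l.
Qed.

Definition EndPi_of_gcentre (x : gcentre gr) : EndPi gr :=
  MkEndPi (gcentre_nat_fin x).

Lemma EndPi_eq_hom (a b : EndPi gr) :
  (forall u M g (m : M), gm_grading M g m -> a u M m = b u M m) -> a = b.
Proof.
move=> ab; apply: EndPi_eq => u M m.
elim/(gr_ind (D := gm_grading M)): m => [g m gm|m n IHm IHn]; first exact: ab gm.
by rewrite !sn_linD IHm IHn.
Qed.

Lemma EndPi_of_gcentre_hom x u M g (m : M) : gm_grading M g m ->
  EndPi_of_gcentre x u M m = gm_act (gr_comp gr u (x (- g))) m.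
Proof. exact: gcentre_act_hom. Qed.

Lemma EndPi_of_gcentre_linear : linear EndPi_of_gcentre.
Proof.
move=> c x y; apply: EndPi_eq_hom => u M g m gm.
rewrite ep_addE ep_scaleE !(EndPi_of_gcentre_hom _ _ gm) /=.
by rewrite linearP gm_act_linl.
Qed.

Lemma EndPi_of_gcentre1 : EndPi_of_gcentre 1 = 1.
Proof.
apply: EndPi_eq_hom => u M g m gm.
rewrite (EndPi_of_gcentre_hom _ _ gm) ep_oneE /= (gr_comp_hom (gr_one gr)).
by case: eqP => _; rewrite ?gm_act1 ?gm_act0l.
Qed.

(** On m of degree g, x_(u - h) acts first and raises the degree to u - h + g, so y_h is taken at
    -(u - h + g). Moving it to the right past x_(u - h)(-g) shifts its index back to -g, which
    leaves x_(u - h)(-g) y_h(-g), a summand of the degree u component of (x y)(-g). *)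
Lemma EndPi_of_gcentreM x y :
  EndPi_of_gcentre (x * y) = EndPi_of_gcentre y * EndPi_of_gcentre x.
Proof.
apply: EndPi_eq_hom => u M g m gm.
rewrite (@ep_mulE _ _ _ _ _ _ (gr_supp gr)) ?gr_supp_uniq //.
  rewrite (EndPi_of_gcentre_hom _ _ gm) [(x * y : gcentre gr) _]/= gr_comp_mul.
  rewrite gm_act_suml; apply: eq_bigr => h _; rewrite (EndPi_of_gcentre_hom x _ gm).
  rewrite (@EndPi_of_gcentre_hom _ _ _ (u - h + g)); last first.
    by apply: gm_act_deg => //; exact: gr_comp_deg.
  have /gcentre_predP yx := gr_comp_gcentre h y.
  rewrite -gm_actM (yx _ _ _ (gr_comp_deg _ _ _)).
  by rewrite opprD addrAC addNr add0r.
move=> h hs N n /=.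
by rewrite /gcentre_act big1 // => i _; rewrite gr_comp_supp // gm_act0l.
Qed.

(** * The inverse map, by evaluation at 1 in the shifts of A *)

Lemma regular_one_deg g : gm_grading (shift g (regular gr)) (- g) (1 : A).
Proof. by rewrite shift_degE addNr; exact: gr_one. Qed.

Lemma EndPi_of_gcentre_one (x : gcentre gr) u g :
  EndPi_of_gcentre x u (shift g (regular gr)) (1 : A) = gr_comp gr u (x g).
Proof.
by rewrite (EndPi_of_gcentre_hom _ _ (regular_one_deg g)) opprK; exact: mulr1.
Qed.

Definition EndPi_supp (a : EndPi gr) : seq G := s2val (cid2 (ep_supp a)).

Lemma EndPi_supp_uniq a : uniq (EndPi_supp a).
Proof. by rewrite /EndPi_supp; case: cid2. Qed.

Lemma EndPi_suppP a u M (m : M) : u \notin EndPi_supp a -> a u M m = 0.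
Proof. by rewrite /EndPi_supp; case: cid2 => s /= _ sP /sP; apply. Qed.

Definition gcentre_val (a : EndPi gr) (g : G) : A :=
  \sum_(u <- EndPi_supp a) (a u (shift g (regular gr)) (1 : A) : A).

Lemma EndPi_one_central (a : EndPi gr) u g h (y : A) : gr h y ->
  (a u (shift g (regular gr)) (1 : A) : A) * y =
  y * (a u (shift (g + h) (regular gr)) (1 : A) : A).
Proof.
move=> hy; have /= -> := sn_natural (a u) (rmul_map g hy) (1 : A).
(* Naturality has turned the left side into the value at 1 * y; reading this element as y acting on
   1, A-linearity pulls y out. *)
rewrite mul1r -[in LHS](mulr1 y).
exact (gh_act (a u (shift (g + h) (regular gr))) y (1 : A)).
Qed.

Lemma gcentre_val_central a : gcentre_val a \in gcentre_pred gr.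
Proof.
apply/gcentre_predP => g h y hy; rewrite mulr_suml mulr_sumr.
by apply: eq_bigr => u _; exact: EndPi_one_central.
Qed.

Definition gcentre_of_EndPi a : gcentre gr := Gcentre (gcentre_val_central a).

(** The element 1 has degree -g in Pi_g A, and the degree -g part of Pi_u Pi_g A is A_(-g + u + g) =
    A_u. *)
Lemma EndPi_one_deg (a : EndPi gr) u g :
  gr u (a u (shift g (regular gr)) (1 : A) : A).
Proof.
have := gh_deg (a u (shift g (regular gr))) (regular_one_deg g).
by rewrite !shift_degE addrAC addNr add0r.
Qed.

(** The summands of [gcentre_val] are homogeneous of their own index, so they form the homogeneous
    decomposition, which is unique. *)
Lemma gr_comp_gcentre_of_EndPi (a : EndPi gr) u g :
  gr_comp gr u (gcentre_of_EndPi a g) = a u (shift g (regular gr)) (1 : A).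
Proof.
pose y u : A := a u (shift g (regular gr)) (1 : A).
apply: (@gr_comp_eq _ _ _ gr _ _ y (EndPi_supp_uniq a)) => //.
- by move=> h hs; exact: (EndPi_suppP (M := shift g (regular gr))).
- by move=> h; exact: EndPi_one_deg.
Qed.

Lemma EndPi_of_gcentreK : cancel EndPi_of_gcentre gcentre_of_EndPi.
Proof.
move=> x; apply/val_inj/funext => g /=.
rewrite [RHS](gr_supp_sum gr) [LHS](gr_supp_sum gr); apply: eq_bigr => u _.
by rewrite gr_comp_gcentre_of_EndPi EndPi_of_gcentre_one.
Qed.

Lemma gcentre_of_EndPiK : cancel gcentre_of_EndPi EndPi_of_gcentre.
Proof.
move=> a; apply: EndPi_eq_hom => u M g m gm.
rewrite (EndPi_of_gcentre_hom _ _ gm) gr_comp_gcentre_of_EndPi.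
(* The orbit map Pi_(-g) A -> M sends 1 to m, so naturality carries the value of a at 1 to its value
   at m. *)
by have /= -> := sn_natural (a u) (orbit_map gm) (1 : A); rewrite gm_act1.
Qed.

Lemma EndPi_of_gcentre_deg (g : G) (x : gcentre gr) :
  gcentre_grading gr g x <-> EndPi_grading gr g (EndPi_of_gcentre x).
Proof.
split=> [gx u ug|gx h].
  apply: shift_nat_eq => M m /=; rewrite /gcentre_act big1 // => i _.
  by rewrite (gr_comp_hom (gx _)) (negbTE ug) gm_act0l.
rewrite [x h](gr_supp_sum gr); suff -> : \sum_(u <- gr_supp gr) gr_comp gr u (x h)
  = gr_comp gr g (x h) by exact: gr_comp_deg.
rewrite (@big_support _ _ _ [:: g]) ?gr_supp_uniq ?big_seq1 // => u.
  exact: gr_comp_supp.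
(* For u different from g, the degree u component of x h is the value at 1 in Pi_h A of a
   transformation that is zero by [gx]. *)
by rewrite inE -EndPi_of_gcentre_one => /gx ->.
Qed.

End GradedModule.

Theorem theorem32 (k : closedFieldType) (G : zmodType) (A : fdimAlgType k)
    (gr : alg_grading G A) :
  exists f : (gcentre gr)^c -> EndPi gr,
    [/\ linear f,
        GRing.monoid_morphism f,
        bijective f &
        forall (g : G) (x : gcentre gr),
          gcentre_grading gr g x <-> EndPi_grading gr g (f x)].
Proof.
exists (@EndPi_of_gcentre k G A gr); split.
- exact: EndPi_of_gcentre_linear.
- split; first exact: EndPi_of_gcentre1.
  (* The product of x and y in the opposite algebra is y * x in [gcentre gr], which undoes the
     reversal. *)
  by move=> x y; exact: EndPi_of_gcentreM.
- exact: Bijective (@EndPi_of_gcentreK _ _ _ _) (@gcentre_of_EndPiK _ _ _ _).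
- exact: EndPi_of_gcentre_deg.
Qed.
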